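(* Let $n\ge 2$ be an even integer and let $G$ be isomorphic to the group $V_{8n}=\langle a,b : a^{2n}=b^4=1,\ b^{-1}ab^{-1}=bab=a^{-1}\rangle$ of order $8n$. Let $\Gamma_G$ be the non-commuting graph of $G$. Then its signless Laplacian spectrum is $$\left\{(8n-8)^{3n},\ (4n)^{4n-5},\ (8n-12)^{n-1},\ \left(8n-6+2\sqrt{8n^2-16n+9}\right)^1,\ \left(8n-6-2\sqrt{8n^2-16n+9}\right)^1\right\},$$ its Laplacian spectrum is $\{(0)^1,\ (4n)^{4n-5},\ (8n-8)^{3n},\ (8n-4)^{n}\}$, and its adjacency spectrum is $$\left\{(0)^{7n-5},\ (-4)^{n-1},\ \left(2(n-1)+2\sqrt{(n-1)(5n-1)}\right)^1,\ \left(2(n-1)-2\sqrt{(n-1)(5n-1)}\right)^1\right\}.$$ Further, $$LE^+(\Gamma_G)=\begin{cases}\frac{24n^3-64n^2+32n+12}{2n-1}+4\sqrt{8n^2-16n+9}, & \text{if } n\le 4,\\[2pt] \frac{32n^3-112n^2+96n-12}{2n-1}+4\sqrt{8n^2-16n+9}, & \text{if } n\ge 6,\end{cases}$$ $$LE(\Gamma_G)=\frac{8n(4n^2-10n+7)}{2n-1}\quad\text{and}\quad E(\Gamma_G)=4(n-1)+4\sqrt{(n-1)(5n-1)}.$$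
   Context: For a finite non-abelian group $G$ with center $Z(G)$, the non-commuting graph $\Gamma_G$ is the simple undirected graph with vertex set $G\setminus Z(G)$ in which $x,y$ are adjacent iff $xy\ne yx$. For a finite simple graph $\mathcal G$ with vertex set $v(\mathcal G)$, edge set $e(\mathcal G)$, adjacency matrix $A(\mathcal G)$ and diagonal degree matrix $D(\mathcal G)$, the adjacency, Laplacian and signless Laplacian spectra are the multisets of eigenvalues of $A(\mathcal G)$, $L(\mathcal G)=D(\mathcal G)-A(\mathcal G)$ and $Q(\mathcal G)=D(\mathcal G)+A(\mathcal G)$ respectively. The notation $\{(\gamma_1)^{d_1},\dots,(\gamma_l)^{d_l}\}$ means the multiset in which $\gamma_r$ is listed $d_r$ times (coinciding listed values have their multiplicities added). With sums counted with multiplicity, $E(\mathcal G)=\sum_\lambda|\lambda|$ over the adjacency spectrum, $LE(\mathcal G)=\sum_\beta\left|\beta-\frac{2|e(\mathcal G)|}{|v(\mathcal G)|}\right|$ over the Laplacian spectrum, and $LE^+(\mathcal G)=\sum_\gamma\left|\gamma-\frac{2|e(\mathcal G)|}{|v(\mathcal G)|}\right|$ over the signless Laplacian spectrum. *)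

(* Defs.v *)
From mathcomp Require Import all_boot all_order all_algebra all_fingroup all_solvable.

Set Implicit Arguments.
Unset Strict Implicit.
Unset Printing Implicit Defensive.

Import Order.TTheory GRing.Theory Num.Theory.
Local Open Scope ring_scope.

Record sgraph := SGraph {
  vertex :> finType;
  adj : rel vertex;
  adj_sym : symmetric adj;
  adj_irr : irreflexive adj }.

Section Graph.
Variable g : sgraph.

Definition edges : {set {set g}} :=
  [set [set p.1; p.2] | p : g * g & adj p.1 p.2].

Definition degree (x : g) : nat := #|[set y | adj x y]|.

End Graph.

(* The roots of the characteristic polynomial of M, listed with multiplicity.
   The order of the list is unspecified: compare such lists with perm_eq. *)
Definition eigenvalues (C : numClosedFieldType) n (M : 'M[C]_n) : seq C :=
  sval (closed_field_poly_normal (char_poly M)).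

Lemma eigenvaluesP (C : numClosedFieldType) n (M : 'M[C]_n) :
  char_poly M = \prod_(z <- eigenvalues M) ('X - z%:P).
Proof.
rewrite /eigenvalues; case: closed_field_poly_normal => r /= {1}->.
by rewrite (monicP (char_poly_monic M)) scale1r.
Qed.

Section Spectra.
Variables (C : numClosedFieldType) (g : sgraph).

Definition adj_mx : 'M[C]_#|g| :=
  \matrix_(i, j) (adj (enum_val i) (enum_val j))%:R.

Definition deg_mx : 'M[C]_#|g| :=
  diag_mx (\row_i (degree (enum_val i))%:R).

Definition laplacian_mx := deg_mx - adj_mx.

Definition signless_mx := deg_mx + adj_mx.

Definition adj_spectrum : seq C := eigenvalues adj_mx.
Definition laplacian_spectrum : seq C := eigenvalues laplacian_mx.
Definition signless_spectrum : seq C := eigenvalues signless_mx.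

Definition avg_degree : C := (2 * #|edges g|)%:R / #|g|%:R.

Definition energy : C := \sum_(z <- adj_spectrum) `|z|.

Definition laplacian_energy : C :=
  \sum_(z <- laplacian_spectrum) `|z - avg_degree|.

Definition signless_energy : C :=
  \sum_(z <- signless_spectrum) `|z - avg_degree|.

End Spectra.

Section NonCommuting.
Variables (gT : finGroupType) (G : {group gT}).

Definition noncentral : finType := {x : gT | x \in G :\: 'Z(G)%g}.

Definition nc_adj : rel noncentral :=
  fun x y => (val x * val y != val y * val x)%g.

Lemma nc_adj_sym : symmetric nc_adj.
Proof. by move=> x y; rewrite /nc_adj eq_sym. Qed.

Lemma nc_adj_irr : irreflexive nc_adj.
Proof. by move=> x; rewrite /nc_adj eqxx. Qed.

Definition nc_graph : sgraph := SGraph nc_adj_sym nc_adj_irr.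

(* The presented group is finite, so being its largest finite quotient (the
   meaning of \isog Grp) amounts to being isomorphic to it. *)
Definition is_V8n (n : nat) : Prop :=
  (G \isog Grp (a : b : a ^+ (2 * n) = b ^+ 4 = 1,
                        b^-1 * a * b^-1 = b * a * b = a^-1))%g.

End NonCommuting.

(* Main.v *)
(* The elements a and z = b^2 commute and a^b = a^-1 z, so A = <a, z> is an
   abelian subgroup of index 2.  Counting in the product A<b> bounds |G| by 8n,
   and a permutation model on Z_2n x Z_4 shows that 8n is attained; hence
   |A| = 4n, and for n even Z(G) = <a^n, z> has order 4.  An element outside A
   commutes exactly with its coset of Z(G) outside the centre, so the graph is
   complete multipartite, with one part of size 4n - 4 and n parts of size 4.
   With U the incidence matrix between vertices and parts, all three matrices
   have the form D + c (J - U U^T), where D is constant on the parts; Sylvester's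
   identity det (1 + XY) = det (1 + YX), used once for U U^T and once for J,
   gives the characteristic polynomial at all but finitely many points. *)

Require Import Defs.
From mathcomp Require Import all_boot all_order all_algebra all_fingroup all_solvable.
From mathcomp Require Import ring zify.

Set Implicit Arguments.
Unset Strict Implicit.
Unset Printing Implicit Defensive.

Import Order.TTheory GRing.Theory Num.Theory.

(* Here oX is the order of X, [i = |A :&: <b>|] and [t = |<a> :&: <z>|], so the
   last two hypotheses are product formulas; the lower bound on [oG] turns all
   the upper bounds into equalities. *)
Lemma V8n_orders n oG oA ob oa oz i t :
  0 < n -> 8 * n <= oG -> 0 < i -> 0 < t -> 0 < oz ->
  ob <= 2 * oz -> oz <= 2 -> ob <= 4 -> oa <= 2 * n -> oz <= i ->
  oA * ob = oG * i -> oa * oz = oA * t ->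
  [/\ oG = 8 * n, oA = 4 * n, oa = 2 * n, oz = 2 & t = 1].
Proof.
move=> n0 G8 i0 t0 z0 b2z z2 b4 a2n zi AbGi azAt.
have oAt : oA <= oA * t by rewrite leq_pmulr.
have oz2 : oz = 2.
  suff : oz != 1 by lia.
  apply/eqP=> oz1; rewrite oz1 muln1 in azAt.
  have : oA * ob <= 2 * n * 2 by apply: leq_mul; lia.
  have : oG * 1 <= oG * i by rewrite leq_mul.
  by lia.
rewrite oz2 in azAt zi.
have Ab : oA * ob <= 4 * n * 4 by apply: leq_mul; lia.
have Gi : oG * 2 <= oG * i by rewrite leq_mul.
have oG8 : oG = 8 * n by lia.
have oA4 : oA = 4 * n.
  apply/eqP; rewrite eqn_leq; apply/andP; split; first by lia.
  by have : oA * ob <= oA * 4 by [rewrite leq_mul]; lia.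
rewrite oA4 in oAt azAt *.
have : 4 * n * t <= 4 * n * 1 by lia.
by rewrite leq_pmul2l; [split; lia|lia].
Qed.

Local Open Scope ring_scope.

(** * The group V_8n *)

Section V8nModel.
Variable n : nat.
Hypothesis n_ge2 : (2 <= n)%N.

Let T := ('Z_(2 * n) * 'Z_4)%type.
(** Right multiplication by [a] and [b] in V_8n, where the point [(i, j)] stands for
    [a^((-1)^j i) b^j]. *)
Let fa (u : T) : T := (u.1 + 1, - u.2).
Let fb (u : T) : T := (- u.1, u.2 + 1).

Let fa_inj : injective fa.
Proof.
apply: (can_inj (g := fun u : T => (u.1 - 1, - u.2))) => u.
by rewrite /= addrK opprK -surjective_pairing.
Qed.

Let fb_inj : injective fb.
Proof.
apply: (can_inj (g := fun u : T => (- u.1, u.2 - 1))) => u.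
by rewrite /= addrK opprK -surjective_pairing.
Qed.

Let a := perm fa_inj.
Let b := perm fb_inj.

Let aXE k (u : T) : (a ^+ k)%g u = (u.1 + k%:R, (-1) ^+ k * u.2).
Proof.
elim: k u => [|k IHk] u.
  by rewrite expg0 perm1 addr0 mul1r -surjective_pairing.
by rewrite expgSr permM IHk permE /fa /= exprS -addrA -natr1 mulN1r mulNr.
Qed.

Let bXE k (u : T) : (b ^+ k)%g u = ((-1) ^+ k * u.1, u.2 + k%:R).
Proof.
elim: k u => [|k IHk] u.
  by rewrite expg0 perm1 addr0 mul1r -surjective_pairing.
by rewrite expgSr permM IHk permE /fb /= exprS -addrA -natr1 mulN1r mulNr.
Qed.

Lemma V8n_model : exists (rT : finGroupType) (a b : rT),
  [/\ (a ^+ (2 * n) = 1)%g, (b ^+ 4 = 1)%g, (b^-1 * a * b^-1 = a^-1)%g,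
      (b * a * b = a^-1)%g & (8 * n <= #|(<[a]> <*> <[b]>)%g|)%N].
Proof.
have n2_gt1 : (1 < 2 * n)%N by lia.
have b4 : (b ^+ 4 = 1)%g.
  apply/permP=> u; rewrite bXE perm1 -signr_odd mul1r pchar_Zp //.
  by rewrite addr0 -surjective_pairing.
exists {perm T}, a, b; split=> //.
- apply/permP=> u; rewrite aXE perm1 -signr_odd oddM mul1r.
  by rewrite pchar_Zp // addr0 -surjective_pairing.
(* Since [b^-1 = b^3], this is the relation [b^-1 a b^-1 = a^-1] solved for [b], free of
   inverses. *)
- have aba : (a * b ^+ 3 * a = b)%g.
    apply/permP=> u; rewrite 2!permM bXE !permE /fa /fb /=.
    have -> : - (- u.2 + 3) = u.2 + 1.
      by rewrite opprD opprK; congr +%R; apply: val_inj.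
    by congr (_, _); ring.
  have -> : (b^-1 = b ^+ 3)%g.
    by apply/eqP; rewrite eq_invg_mul -expgS b4.
  by apply/eqP; rewrite eq_sym eq_invg_mul (mulgA a) (mulgA a) aba -expgS b4.
- apply/eqP; rewrite eq_sym eq_invg_mul; apply/eqP/permP=> u.
  rewrite !permM perm1 !permE /fa /fb /= [RHS]surjective_pairing.
  by congr (_, _); ring.
(* The image of [(0, 0)] under [a^i b^j] reveals [j]; once [b^j] is cancelled, the same point
   reveals [i]. So the [2n * 4] products are distinct. *)
pose f (u : T) := (a ^+ u.1 * b ^+ u.2)%g.
have f_inj : injective f.
  move=> [i j] [k l] fE.
  have /(congr1 snd) := congr1 (fun s : {perm T} => s 0) fE.
  rewrite !permM !aXE !bXE /= !mulr0 !add0r !natr_Zp => jl.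
  move: fE; rewrite /f jl => /mulIg/(congr1 (fun s : {perm T} => (s 0).1)).
  by rewrite !aXE /= !add0r !natr_Zp => ->.
have -> : (8 * n = #|f @: setT|)%N.
  by rewrite card_imset // cardsT card_prod !card_ord !Zp_cast //; lia.
apply/subset_leq_card/subsetP=> _ /imsetP[[i j] _ ->].
by rewrite groupM ?groupX // mem_gen // inE cycle_id ?orbT.
Qed.

End V8nModel.

(** * Groups with an abelian subgroup of index 2 *)

Section AbelianIndex2.
Local Open Scope group_scope.
Variables (gT : finGroupType) (G A : {group gT}).
Hypotheses (sAG : A \subset G) (abA : abelian A) (iA : #|G : A| = 2%N).
Hypothesis nabG : ~~ abelian G.

Lemma gen_index2 x : x \in G :\: A -> G \subset A <*> <[x]>.
Proof.
move=> GAx; apply/subsetP=> y Gy; have [Ay|A'y] := boolP (y \in A).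
  by rewrite mem_gen // inE Ay.
have: y \in A :* x by rewrite (rcoset_index2 sAG iA GAx) inE A'y.
by case/rcosetP=> c Ac ->; rewrite groupM ?mem_gen // inE ?Ac ?cycle_id ?orbT.
Qed.

(** A central element outside [A] would generate, together with the abelian group [A], all of [G],
    making [G] abelian. *)
Lemma center_sub_index2 : 'Z(G) \subset A.
Proof.
apply/subsetP=> z Zz; apply: contraR nabG => A'z.
have GAz: z \in G :\: A by rewrite inE A'z (subsetP (center_sub G)).
apply: abelianS (gen_index2 GAz) _; rewrite abelianY abA cycle_abelian.
by rewrite cycle_subG (subsetP (centS sAG)) //; case/centerP: Zz => _ /centP.
Qed.

(** [A] and [x] generate [G], and [y] already commutes with the abelian group [A]. *)
Lemma center_index2P x y :
  x \in G :\: A -> y \in A -> reflect (commute x y) (y \in 'Z(G)).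
Proof.
move=> GAx Ay; apply: (iffP idP) => [/centerP[_ cy]|cxy].
  by apply/esym/cy; case/setDP: GAx.
rewrite inE (subsetP sAG) //= -sub_cent1 (subset_trans (gen_index2 GAx)) //.
rewrite join_subG sub_cent1 (subsetP abA) //= cycle_subG; exact/cent1P.
Qed.

(** A label for the part of [x]. The label [A] stands for the part [A :\: 'Z(G)], since vertices are
    noncentral. *)
Definition nc_part (x : nc_graph G) : {set gT} :=
  if val x \in A then A : {set gT} else 'Z(G) :* val x.

(** For [x] and [y] both outside [A], index 2 gives [y = c x] with [c] in [A]; then [y] commutes
    with [x] iff [c] does, iff [c] is central. If just one of them lies in [A], commuting would make
    that one central. *)
Lemma nc_adj_part (x y : nc_graph G) : adj x y = (nc_part x != nc_part y).
Proof.
rewrite /adj /= /nc_adj /nc_part; congr (~~ _).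
case: x y => [x Gx] [y Gy] /=.
have [/setDP[{}Gx Z'x] /setDP[{}Gy Z'y]] := (Gx, Gy).
have neqA t : t \notin A -> A <> 'Z(G) :* t :> {set gT}.
  by move=> /negP A't AE; apply: A't; rewrite AE rcoset_refl.
have [Ax|A'x] := boolP (x \in A); have [Ay|A'y] := boolP (y \in A); rewrite /=.
- by rewrite eqxx; apply/eqP/(centsP abA).
- rewrite [RHS](introF eqP (neqA y A'y)); apply: contraNF Z'x => /eqP cxy.
  by apply/(center_index2P (x := y)) => //; rewrite inE A'y.
- rewrite [RHS]eq_sym [RHS](introF eqP (neqA x A'x)).
  apply: contraNF Z'y => /eqP cxy.
  by apply/(center_index2P (x := x)) => //; rewrite inE ?A'x.
have GAx: x \in G :\: A by rewrite inE A'x.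
have: y \in A :* x by rewrite (rcoset_index2 sAG iA GAx) inE A'y.
case/rcosetP=> c Ac ->{y Gy Z'y A'y}; apply/eqP/eqP.
  rewrite mulgA => /mulIg cxc; apply/rcoset_eqP.
  rewrite mem_rcoset invMg mulKVg groupV.
  by apply/(center_index2P GAx Ac).
move/rcoset_eqP; rewrite mem_rcoset invMg mulKVg groupV.
by move/(center_index2P GAx Ac) => cxc; rewrite mulgA cxc.
Qed.

Definition nc_small_parts : {set {set gT}} :=
  rcosets 'Z(G) G :\: rcosets 'Z(G) A.

Lemma card_nc_small_parts :
  #|nc_small_parts| = (#|G : 'Z(G)| - #|A : 'Z(G)|)%N.
Proof. by rewrite cardsD (setIidPr _) // imsetS. Qed.

Lemma nc_small_partP k :
  reflect (exists2 x, x \in G :\: A & k = 'Z(G) :* x) (k \in nc_small_parts).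
Proof.
apply: (iffP setDP) => [[/rcosetsP[x Gx ->] A'x]|[x /setDP[Gx A'x] ->]].
  exists x => //; rewrite inE Gx andbT; apply: contra A'x => Ax.
  by apply/rcosetsP; exists x.
split; first by apply/rcosetsP; exists x.
apply: contra A'x => /rcosetsP[y Ay /rcoset_eqP/rcosetP[z Zz ->]].
by rewrite groupM // (subsetP center_sub_index2).
Qed.

Lemma nc_big_part : (A : {set gT}) \notin nc_small_parts.
Proof.
apply/nc_small_partP=> -[x /setDP[_ A'x] AE].
by rewrite AE rcoset_refl in A'x.
Qed.

(** The part labelled [A] loses the central elements, whereas a coset of the centre outside [A]
    consists of vertices only. *)
Lemma card_nc_part (k : {set gT}) : #|[set t | nc_part t == k]| =
  (if k == A then #|A| - #|'Z(G)| else if k \in nc_small_parts then #|'Z(G)|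
   else 0)%N.
Proof.
have -> : #|[set t | nc_part t == k]| =
    #|[set x in G :\: 'Z(G) |
        (if x \in A then A : {set gT} else 'Z(G) :* x) == k]|.
  rewrite -(card_imset _ val_inj); apply: eq_card => x; rewrite inE.
  apply/imsetP/andP => [[t]|[Gx xk]].
    by rewrite inE => ? ->; split=> //; apply: valP t.
  by exists (Sub x Gx); rewrite ?inE.
have [->|kA] := eqVneq k A.
  rewrite -(setIidPr center_sub_index2) -cardsD.
  apply: eq_card => x; rewrite !inE; have [Ax|A'x] := boolP (x \in A).
    by rewrite eqxx andbT (subsetP sAG).
  case: eqP => [AE|_]; rewrite ?andbF //.
  by rewrite -AE rcoset_refl in A'x.
case: ifPn => [/nc_small_partP[x /setDP[Gx A'x] ->]|kB].
  rewrite -(card_rcoset 'Z(G) x); apply: eq_card => y; rewrite inE.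
  apply/andP/idP => [[]|xy].
    case: ifPn => // [_|A'y] _; last by move/eqP<-; apply: rcoset_refl.
    by move/eqP=> AE; rewrite AE rcoset_refl in A'x.
  have A'y : y \notin A.
    case/rcosetP: xy A'x => z Zz ->; apply: contra => Azx.
    by rewrite -(groupMl _ (subsetP center_sub_index2 _ Zz)).
  rewrite (negPf A'y) (rcoset_eqP xy) eqxx; split=> //.
  rewrite inE (contra (subsetP center_sub_index2 y)) //.
  by case/rcosetP: xy => z Zz ->; rewrite groupM // (subsetP (center_sub G)).
apply/eqP; rewrite cards_eq0 -subset0; apply/subsetP=> x.
rewrite inE => /andP[/setDP[Gx _]]; case: ifPn => [_ /eqP AE|A'x /eqP xE].
  by rewrite AE eqxx in kA.
by case/nc_small_partP: kB; exists x; rewrite ?inE ?A'x.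
Qed.

End AbelianIndex2.

(** * Center and abelian subgroup of V_8n *)

Section V8nStructure.
Local Open Scope group_scope.

Lemma V8n_structure (n : nat) (gT : finGroupType) (G : {group gT}) :
    (2 <= n)%N -> ~~ odd n -> is_V8n G n ->
  exists A : {group gT}, [/\ A \subset G, abelian A, ~~ abelian G &
    [/\ #|G| = 8 * n, #|A| = 4 * n & #|'Z(G)%g| = 4]%N].
Proof.
move=> n_ge2 n_even G_V8n.
(* The permutation model satisfies the relations, hence is a homomorphic image of [G]. *)
have G_ge : (8 * n <= #|G|)%N.
  have [rT [a [b [a2n b4 r1 r2 H_ge]]]] := V8n_model n_ge2.
  apply: leq_trans H_ge _; apply: leq_homg; rewrite G_V8n.
  by apply/existsP; exists (a, b); rewrite /= !xpair_eqE a2n b4 r1 r2 !eqxx.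
have /existsP[[a b] /= /eqP[genG a2n b4 r1 r2]] := isoGrp_hom G_V8n.
pose z := b ^+ 2.
have z2 : z ^+ 2 = 1 by rewrite -expgM.
have Ga : a \in G by rewrite -genG mem_gen // inE cycle_id.
have Gb : b \in G by rewrite -genG mem_gen // inE cycle_id orbT.
have aJb : a ^ b = a^-1 * z by rewrite -r1 /z expgS expg1 conjgE !mulgA mulgKV.
(* [b^2 a = b a^-1 b^-1 = a b^-2], and [b^-2 = b^2]. *)
have cza : commute z a.
  have ba : b * a = a^-1 * b^-1 by rewrite -r2 mulgK.
  have ba' : b * a^-1 = a * b^-1 by rewrite -r1 !mulgA mulgV mul1g.
  rewrite /commute /z expgS expg1 -mulgA ba mulgA ba' -mulgA -invMg.
  by congr (_ * _); apply/eqP; rewrite eq_invg_mul -[b * b]/(b ^+ 2) -expgD b4.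
have czb : commute z b by apply/commute_sym/commuteX.
have zJb : z ^ b = z by rewrite conjgE czb mulKg.
pose A := <[a]> <*> <[z]>.
have Aa : a \in A by rewrite mem_gen // inE cycle_id.
have Az : z \in A by rewrite mem_gen // inE cycle_id orbT.
have sAG : A \subset G by rewrite join_subG !cycle_subG Ga groupX.
have cza' : <[z]> \subset 'C(<[a]>) by apply: cents_cycle.
have abA : abelian A by rewrite abelianY !cycle_abelian.
have nAb : <[b]> \subset 'N(A).
  rewrite cycle_subG inE conjYg -!cycleJ join_subG !cycle_subG aJb.
  by rewrite zJb groupM ?groupV.
have defG : A * <[b]> = G.
  rewrite -norm_joinEr //; apply/eqP; rewrite -genG eqEsubset !join_subG.
  rewrite !cycle_subG groupX ?mem_gen ?inE ?cycle_id ?orbT //=.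
  by rewrite -/A Aa.
have n0 : (0 < n)%N by apply: leq_trans n_ge2.
(* The relations bound the orders of [a], [b] and [z] only from above; the product formulas for
   [A <b>] and [<a> <z>], with [|G| >= 8n], force the values listed. *)
have [oG oA oa oz oI] : [/\ #|G| = 8 * n, #|A| = 4 * n, #[a] = 2 * n, #[z] = 2
    & #|<[a]> :&: <[z]>| = 1]%N.
  have zI : <[z]> \subset A :&: <[b]> by rewrite cycle_subG inE Az mem_cycle.
  apply: (V8n_orders (ob := #[b]) (i := #|A :&: <[b]>|)) => //.
  - by rewrite dvdn_leq ?muln_gt0 ?order_gt0 // order_dvdn expgM -/z expg_order.
  - by rewrite dvdn_leq // order_dvdn z2.
  - by rewrite dvdn_leq // order_dvdn b4.
  - by rewrite dvdn_leq ?muln_gt0 // order_dvdn a2n.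
  - exact: subset_leq_card.
  - by rewrite -defG -mul_cardG.
  - by rewrite mul_cardG -cent_joinEr.
have tiaz : <[a]> :&: <[z]> = 1 by apply/eqP; rewrite trivg_card1 oI.
have z1 : z <> 1 by move=> z1; rewrite z1 order1 in oz.
have tiE y : y \in <[a]> -> y \in <[z]> -> y = 1.
  by move=> ay zy; apply/set1gP; rewrite -tiaz inE ay.
have aXJb k : (a ^+ k) ^ b = a ^- k * z ^+ k.
  by rewrite conjXg aJb expgMn ?expgVn //; apply/commute_sym/commuteV.
(* Conjugation by [b] sends [a^n] to [a^-n z^n]; here [z^n = 1] because [n] is even, and
   [a^-n = a^n]. *)
have Za : a ^+ n \in 'Z(G).
  apply/centerP; split=> [|y Gy]; first by rewrite groupX.
  apply/commute_sym/cent1P; move: y Gy; apply/subsetP.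
  rewrite -genG join_subG !cycle_subG; apply/andP; split; apply/cent1P.
    exact/commuteX.
  apply/commute_sym/commgP/conjg_fixP; rewrite aXJb -[n in z ^+ n]odd_double_half.
  rewrite (negPf n_even) -mul2n expgM z2 expg1n mulg1.
  by apply/eqP; rewrite eq_invg_mul -expgD addnn -mul2n a2n.
have Zz : z \in 'Z(G).
  apply/centerP; split=> [|y Gy]; first by rewrite groupX.
  apply/commute_sym/cent1P; move: y Gy; apply/subsetP.
  by rewrite -genG join_subG !cycle_subG; apply/andP; split; apply/cent1P/commute_sym.
(* Otherwise [a = a^-1 z], so [z = a^2] would lie in [<a>], which meets [<z>] trivially. *)
have nabG : ~~ abelian G.
  apply/negP=> /centsP/(_ a Ga b Gb)/commgP/conjg_fixP.
  rewrite aJb => /(canRL (mulKVg _)) zE.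
  by apply/z1/tiE; rewrite ?cycle_id // zE groupM ?cycle_id.
have iA : #|G : A| = 2%N.
  by rewrite -divgS // oG oA -[8%N]/(2 * 4)%N -mulnA mulnK // muln_gt0.
(* If [a^i w] is central with [w] in [<z>], so is [a^i]. Conjugation by [b] then gives
   [a^(2i) = z^i], an element of the trivial intersection, so [2n] divides [2i]. *)
have ZE : 'Z(G) = <[a ^+ n]> * <[z]>.
  apply/eqP; rewrite eq_sym eqEsubset mul_subG ?cycle_subG //=.
  apply/subsetP=> y Zy; have := subsetP (center_sub_index2 sAG abA iA nabG) _ Zy.
  rewrite /= cent_joinEr // => /mulsgP[_ w /cycleP[i ->] zw yE].
  have: a ^+ i \in 'Z(G).
    rewrite -(mulgK w (a ^+ i)) -yE groupM ?groupV //.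
    by apply: subsetP zw; rewrite cycle_subG.
  case/centerP=> _ /(_ b Gb)/commgP/conjg_fixP; rewrite aXJb.
  move/(canRL (mulKVg _)) => zi.
  have /eqP : a ^+ (i + i) = 1.
    rewrite expgD -zi; apply: tiE; last exact: mem_cycle.
    by rewrite zi groupM ?mem_cycle.
  rewrite -order_dvdn oa addnn -mul2n dvdn_pmul2l // => /dvdnP[k iE].
  by rewrite yE mem_mulg // iE mulnC expgM mem_cycle.
have tiZ : <[a ^+ n]> :&: <[z]> = 1.
  by apply/trivgP; rewrite -tiaz setSI // cycle_subG mem_cycle.
exists [group of A]; split=> //; split=> //.
by rewrite ZE TI_cardMg // -!orderE oz orderXdiv oa ?dvdn_mull // mulnK.
Qed.

End V8nStructure.

(** * Spectra of complete multipartite graphs *)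

(** The block matrix with rows [(1, -A)] and [(B, 1)] becomes block lower triangular when multiplied
    by the one with rows [(1, A)] and [(0, 1)]: on the left this leaves [1 + A B] on the diagonal,
    on the right [1 + B A]. *)
Lemma det_1D_mulmxC (R : comNzRingType) m n (A : 'M[R]_(m, n)) (B : 'M_(n, m)) :
  \det (1%:M + A *m B) = \det (1%:M + B *m A).
Proof.
have detE : \det (block_mx 1%:M A 0 1%:M : 'M_(m + n)) = 1.
  by rewrite det_ublock !det1 mulr1.
transitivity (\det (block_mx 1%:M (- A) B 1%:M)).
  rewrite -[RHS]mul1r -[X in _ = X * _]detE -det_mulmx mulmx_block.
  by rewrite !mul1mx !mul0mx !mulmx1 addNr !add0r det_lblock det1 mulr1.
rewrite -[LHS]mulr1 -[X in _ * X = _]detE -det_mulmx mulmx_block.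
by rewrite !mulmx1 !mulmx0 !mul1mx addrN !addr0 det_lblock det1 mul1r addrC.
Qed.

Lemma big_enum_val_type (R : Type) (idx : R) (op : Monoid.com_law idx)
    (T : finType) (F : T -> R) :
  \big[op/idx]_(i < #|T|) F (enum_val i) = \big[op/idx]_t F t.
Proof.
by rewrite [RHS](reindex (@enum_val T predT)) //; apply: onW_bij (enum_val_bij T).
Qed.

Section Multipartite.
Variables (F : fieldType) (T K : finType) (p : T -> K).
Let s k : nat := #|[set t | p t == k]|.

Lemma sum_by_part (h : K -> F) : \sum_t h (p t) = \sum_k (s k)%:R * h k.
Proof.
rewrite (partition_big p predT) //=; apply: eq_bigr => k _.
rewrite (eq_bigr (fun=> h k)) => [|t /eqP-> //].
by rewrite sumr_const mulr_natl; congr (_ *+ _); apply: eq_card => t; rewrite !inE.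
Qed.

Lemma prod_by_part (h : K -> F) : \prod_t h (p t) = \prod_k h k ^+ s k.
Proof.
rewrite (partition_big p predT) //=; apply: eq_bigr => k _.
rewrite (eq_bigr (fun=> h k)) => [|t /eqP-> //].
by rewrite prodr_const; congr (_ ^+ _); apply: eq_card => t; rewrite !inE.
Qed.

Lemma sum_enum_part (i j : 'I_#|T|) :
  \sum_(k < #|K|) (p (enum_val i) == enum_val k)%:R *
     (p (enum_val j) == enum_val k)%:R =
  (p (enum_val i) == p (enum_val j))%:R :> F.
Proof.
rewrite (big_enum_val_type _ (fun k => (p (enum_val i) == k)%:R *
  (p (enum_val j) == k)%:R)) (bigD1 (p (enum_val i))) //= eqxx mul1r eq_sym.
by rewrite big1 ?addr0 // => k /negPf; rewrite eq_sym => ->; rewrite mul0r.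
Qed.

(* With [U] the vertex-part incidence matrix and [E = diag (x - d (p i))], the
   matrix is [(E + c U U^T) (1 - c y 1^T)], where [y = (E + c U U^T)^-1 1] is
   constant on the parts. *)
Lemma det_multipartite (d : K -> F) (c x : F) :
    (forall k, x - d k != 0) -> (forall k, x - d k + c * (s k)%:R != 0) ->
  \det (\matrix_(i < #|T|, j < #|T|)
    ((x - d (p (enum_val i))) *+ (i == j)
      - c * (p (enum_val i) != p (enum_val j))%:R)) =
  (\prod_k ((x - d k) ^+ s k * (1 + c * (s k)%:R / (x - d k)))) *
    (1 - \sum_k c * (s k)%:R / (x - d k + c * (s k)%:R)).
Proof.
move=> xd xs.
pose e : 'rV[F]_#|T| := \row_i (x - d (p (enum_val i))).
pose f : 'rV[F]_#|T| := \row_i (x - d (p (enum_val i)))^-1.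
pose U : 'M[F]_(#|T|, #|K|) := \matrix_(i, k) (p (enum_val i) == enum_val k)%:R.
pose r k := x - d k + c * (s k)%:R.
pose y : 'cV[F]_#|T| := \col_i (r (p (enum_val i)))^-1.
pose N := diag_mx e *m (1%:M + (diag_mx f *m U) *m (c *: U^T)).
have N_E : N = diag_mx e + c *: (U *m U^T).
  rewrite /N mulmxDr mulmx1 !mulmxA mulmx_diag -scalemxAr.
  have -> : \row_j (e 0 j * f 0 j) = const_mx 1.
    by apply/rowP=> i; rewrite !mxE divff.
  by rewrite diag_const_mx mul1mx.
have UUtE i j : (U *m U^T) i j = (p (enum_val i) == p (enum_val j))%:R.
  by rewrite -sum_enum_part mxE; apply: eq_bigr => k _; rewrite !mxE.
have N_ijE i j : N i j = (x - d (p (enum_val i))) *+ (i == j) +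
    c * (p (enum_val i) == p (enum_val j))%:R.
  by rewrite N_E mxE [X in _ + X]mxE UUtE !mxE.
have NyE : N *m y = const_mx 1.
  rewrite N_E; apply/colP=> i; rewrite mulmxDl -scalemxAl mul_diag_mx !mxE.
  under eq_bigr => j _ do rewrite UUtE mxE.
  rewrite (big_enum_val_type _ (fun t => (p (enum_val i) == p t)%:R * (r (p t))^-1)) /=.
  rewrite (sum_by_part (fun k => (p (enum_val i) == k)%:R * (r k)^-1)).
  rewrite (bigD1 (p (enum_val i))) //= eqxx big1 => [|k /negPf]; last first.
    by rewrite eq_sym => ->; rewrite mul0r mulr0.
  by rewrite addr0 mul1r mulrA -mulrDl divff ?xs.
set M := (X in \det X).
have -> : M = N *m (1%:M + y *m const_mx (- c)).
  rewrite mulmxDr mulmx1 mulmxA NyE; apply/matrixP=> i j.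
  rewrite [RHS]mxE N_ijE !mxE big_ord1 !mxE.
  by case: (_ == p _); rewrite /=; ring.
(* The identity turns the rank-one factor into a 1 x 1 determinant. *)
rewrite det_mulmx det_1D_mulmxC; congr (_ * _).
  rewrite det_mulmx det_diag det_1D_mulmxC.
  (* Each vertex lies in a single part, so [U^T E^-1 U] is diagonal, with entry [s k / (x - d k)] at
     [k]. *)
  have -> : 1%:M + c *: U^T *m (diag_mx f *m U) =
      diag_mx (\row_k (1 + c * (s (enum_val k))%:R / (x - d (enum_val k)))).
    apply/matrixP=> k l; rewrite -scalemxAl 4!mxE.
    under eq_bigr => i _ do rewrite mxE mul_diag_mx !mxE.
    rewrite (big_enum_val_type _ (fun t => (p t == enum_val k)%:R *
       ((x - d (p t))^-1 * (p t == enum_val l)%:R))) /=.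
    rewrite (sum_by_part (fun q => (q == enum_val k)%:R *
       ((x - d q)^-1 * (q == enum_val l)%:R))).
    rewrite (bigD1 (enum_val k)) //= eqxx big1 => [|q /negPf->]; last first.
      by rewrite mul0r mulr0.
    rewrite (inj_eq enum_val_inj) !mxE.
    by case: eqP => _ /=; ring.
  rewrite det_diag big_split /= -prod_by_part; congr (_ * _).
    by rewrite -[RHS]big_enum_val_type /=; apply: eq_bigr => i _; rewrite mxE.
  by rewrite -[RHS]big_enum_val_type /=; apply: eq_bigr => i _; rewrite mxE.
rewrite det_mx11 !mxE mulr1n; congr (_ + _).
under eq_bigr => i _ do rewrite !mxE.
rewrite (big_enum_val_type _ (fun t => - c * (r (p t))^-1)) /=.
rewrite (sum_by_part (fun k => - c * (r k)^-1)) -sumrN.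
by apply: eq_bigr => k _; rewrite /r; ring.
Qed.

End Multipartite.

(** The product [h * (u - v)] vanishes at every natural number, and in characteristic 0 these are
    more points than its degree allows. *)
Lemma poly_ext_generic (C : numDomainType) (h u v : {poly C}) :
  h != 0 -> (forall x, h.[x] != 0 -> u.[x] = v.[x]) -> u = v.
Proof.
move=> h0 uv; apply/eqP; rewrite -subr_eq0.
suff /eqP: h * (u - v) = 0 by rewrite mulf_eq0 (negPf h0).
set w := h * _; apply: (@roots_geq_poly_eq0 _ w [seq i%:R | i <- iota 0 (size w)]).
- apply/allP=> _ /mapP[i _ ->]; apply/rootP; rewrite hornerM hornerD hornerN.
  by have [->|/uv->] := eqVneq h.[i%:R] 0; rewrite ?mul0r // subrr mulr0.
- by rewrite map_inj_uniq ?iota_uniq // => i j /eqP; rewrite eqr_nat => /eqP.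
- by rewrite size_map size_iota.
Qed.

Lemma horner_char_poly (R : comNzRingType) n (M : 'M[R]_n) x :
  (char_poly M).[x] = \det (\matrix_(i, j) (x *+ (i == j) - M i j)).
Proof.
rewrite -horner_evalE -det_map_mx; congr (\det _); apply/matrixP=> i j.
by rewrite !mxE /= horner_evalE hornerD hornerN hornerMn hornerX hornerC.
Qed.

Lemma big_tally_seq (R : Type) (idx : R) (op : Monoid.com_law idx) (T : eqType)
    (bs : seq (T * nat)) (F : T -> R) :
  \big[op/idx]_(z <- tally_seq bs) F z =
  \big[op/idx]_(b <- bs) iter b.2 (op (F b.1)) idx.
Proof. by rewrite big_flatten big_map; apply: eq_bigr => b _; rewrite big_nseq. Qed.

(** The polynomial [h] collects the points where the determinant formula would divide by zero. Equal
    products of monic linear factors have the same roots with multiplicity. *)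
Lemma eigenvalues_tally (C : numClosedFieldType) n (M : 'M[C]_n) bs h :
    h != 0 ->
    (forall x, h.[x] != 0 ->
       (char_poly M).[x] = \prod_(b <- bs) (x - b.1) ^+ b.2) ->
  perm_eq (eigenvalues M) (tally_seq bs).
Proof.
move=> h0 Mbs; apply: prod_XsubC_eq; rewrite -eigenvaluesP.
apply: poly_ext_generic h0 _ => x /Mbs->.
rewrite horner_prod big_tally_seq; apply: eq_bigr => b _.
by rewrite hornerXsubC; elim: b.2 => [|k /= <-]; rewrite ?expr0 ?exprS.
Qed.

(** Incident pairs of a vertex and an edge are counted in two ways: each edge has two distinct ends
    because [adj] is irreflexive, and [y |-> [set x; y]] is a bijection from the neighbours of [x]
    to the edges at [x]. *)
Lemma handshake (g : sgraph) : (2 * #|edges g| = \sum_(x : g) degree x)%N.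
Proof.
transitivity (\sum_(e in edges g) #|e|)%N.
  rewrite mulnC -sum_nat_const; apply: eq_bigr => _ /imsetP[[x y] xy ->] /=.
  by rewrite cards2; case: eqP xy => // <-; rewrite inE /= adj_irr.
under eq_bigr => e _ do rewrite -sum1_card.
rewrite (exchange_big_dep predT) //=; apply: eq_bigr => x _.
rewrite sum1dep_card /degree.
have inj : {in [set y | adj x y] &, injective (fun y : g => [set x; y])}.
  move=> y z; rewrite !inE => xy _ /setP/(_ y); rewrite !inE eqxx orbT.
  by case: eqP => [yx|_ /esym/eqP//]; rewrite yx adj_irr in xy.
rewrite -(card_in_imset inj); apply: eq_card => e; rewrite inE.
apply/andP/imsetP => [[/imsetP[[a b]]]|[y]]; rewrite inE /=.
  move=> ab -> /set2P[->|->]; first by exists b; rewrite ?inE.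
  by exists a; rewrite ?inE 1?adj_sym // setUC.
move=> xy ->; rewrite set21; split=> //.
by apply/imsetP; exists (x, y); rewrite ?inE.
Qed.

(** * Complete multipartite graphs with one part of size [m.+1] and [r.+1] parts of size [q.+1] *)

Section OnePlusEqualParts.
Variables (C : numClosedFieldType) (g : sgraph) (K : finType) (p : g -> K).
Variables (k0 : K) (B : {set K}) (m q r : nat).
Hypotheses (adj_p : forall x y, adj x y = (p x != p y)).
Hypotheses (k0B : k0 \notin B) (oB : #|B| = r.+1).
Let s k : nat := #|[set t | p t == k]|.
Hypothesis sE : forall k,
  s k = (if k == k0 then m.+1 else if k \in B then q.+1 else 0)%N.

(** [K] may hold labels of no vertex, since the labels will be arbitrary subsets of a group type;
    such labels must contribute the neutral element. *)
Lemma big_parts (R : Type) (idx : R) (op : Monoid.com_law idx) (F : K -> R) :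
    (forall k, s k = 0%N -> F k = idx) ->
  \big[op/idx]_k F k = op (F k0) (\big[op/idx]_(k in B) F k).
Proof.
move=> F0; rewrite (bigD1 k0) //= (bigID (mem B)) /=.
rewrite [X in op _ (op _ X)]big1 ?Monoid.mulm1 => [|k /andP[k_k0 kB]].
  by congr (op _ _); apply: eq_bigl => k; case: eqP => // ->; rewrite (negPf k0B).
by rewrite F0 // sE (negPf k_k0) (negPf kB).
Qed.

Lemma card_vertices : #|g| = (m.+1 + r.+1 * q.+1)%N.
Proof.
rewrite -sum1_card (partition_big p predT) //=.
rewrite (eq_bigr s) => [|k _]; last first.
  by rewrite sum1dep_card /s; apply: eq_card => t; rewrite !inE.
rewrite big_parts // sE eqxx; congr addn.
rewrite (eq_bigr (fun=> q.+1)) ?sum_nat_const ?oB // => k kB.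
by rewrite sE kB; case: eqP kB => // ->; rewrite (negPf k0B).
Qed.

(** The non-neighbours of a vertex, itself included, form its own part. *)
Lemma degreeE x :
  degree x = (if p x == k0 then r.+1 * q.+1 else m.+1 + r * q.+1)%N.
Proof.
have -> : degree x = (#|g| - s (p x))%N.
  rewrite /degree cardsCs; congr subn; apply: eq_card => y.
  by rewrite !inE adj_p negbK eq_sym.
have : (0 < s (p x))%N by apply/card_gt0P; exists x; rewrite inE.
by rewrite card_vertices !sE; case: eqP => _; [|case: ifP => // _] => _; lia.
Qed.

Lemma card_edges :
  (2 * #|edges g| = m.+1 * (r.+1 * q.+1) + r.+1 * q.+1 * (m.+1 + r * q.+1))%N.
Proof.
rewrite handshake; under eq_bigr => x _ do rewrite degreeE.
rewrite (partition_big p predT) //=.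
rewrite (eq_bigr (fun k => s k * (if k == k0 then r.+1 * q.+1
    else m.+1 + r * q.+1))%N) => [|k _]; last first.
  rewrite (eq_bigr (fun=> if k == k0 then r.+1 * q.+1 else m.+1 + r * q.+1)%N).
    by rewrite sum_nat_cond_const; congr muln; apply: eq_card => t; rewrite !inE.
  by move=> t /eqP->.
rewrite big_parts => [|k -> //]; rewrite sE eqxx; congr addn.
rewrite (eq_bigr (fun=> q.+1 * (m.+1 + r * q.+1))%N) => [|k kB].
  by rewrite sum_nat_const oB mulnA.
by rewrite sE kB; case: eqP kB => // ->; rewrite (negPf k0B).
Qed.

(** One statement serves three matrices: [c] is 1 for the adjacency and signless Laplacian matrices
    and -1 for the Laplacian, and [d0], [d1] are the diagonal entries. The left-hand side is the
    value of [det_multipartite] with denominators cleared: [r] of the [r.+1] factors [b] survive,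
    and the last one joins [a] in clearing the final sum. *)
Lemma eigenvalues_parts (M : 'M[C]_#|g|) (c d0 d1 : C) (bs : seq (C * nat)) :
    (forall i j, M i j =
       (if p (enum_val i) == k0 then d0 else d1) *+ (i == j)
         + c * (adj (enum_val i) (enum_val j))%:R) ->
    (forall x, let a := x - d0 + c * m.+1%:R in let b := x - d1 + c * q.+1%:R in
       (x - d0) ^+ m * (x - d1) ^+ (q * r.+1) * b ^+ r *
         (a * b - c * m.+1%:R * b - c * (r.+1 * q.+1)%:R * a) =
       \prod_(b <- bs) (x - b.1) ^+ b.2) ->
  perm_eq (eigenvalues M) (tally_seq bs).
Proof.
move=> ME bsE.
(* The four factors are the denominators to avoid: [x - d0], [x - d1], [a] and [b]. *)
pose h := ('X - d0%:P) * ('X - d1%:P) * ('X - (d0 - c * m.+1%:R)%:P) *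
  ('X - (d1 - c * q.+1%:R)%:P).
apply: (@eigenvalues_tally _ _ _ _ h) => [|x].
  by rewrite !mulf_neq0 ?polyXsubC_eq0.
rewrite /h !hornerM !hornerXsubC !mulf_eq0 !negb_or !opprB.
rewrite ![x + (_ - _)]addrCA ![_ + (x - _)]addrC.
case/andP=> [/andP[/andP[x0 x1] xa] xb].
rewrite -bsE horner_char_poly.
set a := x - d0 + _ in xa *; set b := x - d1 + _ in xb *.
pose d k := if k == k0 then d0 else d1.
have -> : \matrix_(i, j) (x *+ (i == j) - M i j) = \matrix_(i < #|g|, j < #|g|)
    ((x - d (p (enum_val i))) *+ (i == j)
      - c * (p (enum_val i) != p (enum_val j))%:R).
  by apply/matrixP=> i j; rewrite !mxE ME adj_p mulrnBl opprD addrA.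
have xd k : x - d k != 0 by rewrite /d; case: ifP.
rewrite det_multipartite => [|//|k]; last first.
  rewrite -/(s _) sE /d; case: ifP => // _.
  by case: ifP; rewrite // mulr0 addr0.
have sB k : k \in B -> (s k = q.+1) * (d k = d1).
  by move=> kB; rewrite sE /d kB; case: eqP kB => // ->; rewrite (negPf k0B).
rewrite !big_parts => [|k sk0|k sk0]; rewrite -?/(s k) ?sk0; last 2 first.
- by rewrite mulr0 mul0r.
- by rewrite expr0 mulr0 mul0r addr0 mulr1.
rewrite /= (eq_bigr (fun=> (x - d1) ^+ q * b)) => [|k kB]; last first.
  by rewrite -/(s k) !(sB k kB) exprSr /b; field.
rewrite prodr_const (eq_bigr (fun=> c * q.+1%:R / b)) => [|k kB]; last first.
  by rewrite -/(s k) !(sB k kB).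
rewrite sumr_const oB -/(s k0) sE /d eqxx -/a.
rewrite -[_ / b *+ _]mulr_natr mulnS exprD exprM exprMn natrM exprSr.
have xa_E : (x - d0) * (1 + c * m.+1%:R / (x - d0)) = a by rewrite /a; field.
rewrite -[_ * (x - d0) * _]mulrA xa_E.
move: a b xa xb {xa_E} => a b xa xb; rewrite ![_ ^+ r.+1]exprS.
by field; rewrite xa xb.
Qed.

End OnePlusEqualParts.

(** * Energies *)

Section Energies.
Variables (C : numClosedFieldType) (k : nat) (x y : C).
Hypotheses (yE : y = k%:R) (xE : x = y + 2).
(** The average degree for [x = n]: there are [8n - 4] vertices, and twice the number of edges is
    [48 n (n - 1)]. *)
Let avg : C := 12 * x * (x - 1) / (2 * x - 1).
Let s : C := sqrtC (8 * x ^+ 2 - 16 * x + 9).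
Let t : C := sqrtC ((x - 1) * (5 * x - 1)).

Let y_ge0 : 0 <= y. Proof. by rewrite yE. Qed.
Let x_ge0 : 0 <= x. Proof. by rewrite xE addr_ge0. Qed.

(** Most polynomials in [x] met below have nonnegative coefficients once written in [y = x - 2];
    these rules then settle their signs. *)
Let posE := (@addr_ge0 C, @mulr_ge0 C, @exprn_ge0 C, @ler0n C, @ler01 C,
  y_ge0, x_ge0).

Let w_gt0 : 0 < 2 * x - 1.
Proof.
have -> : 2 * x - 1 = 2 * y + 3 by rewrite xE; ring.
by rewrite ltr_wpDl ?posE ?ltr0n.
Qed.

Let w_neq0 : 2 * x - 1 != 0. Proof. by rewrite gt_eqF. Qed.

Let norm_div (u v : C) :
  0 <= v -> u * (2 * x - 1) = v \/ u * (2 * x - 1) = - v ->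
  `|u| = v / (2 * x - 1).
Proof.
move=> v0 uv; rewrite -(mulfK w_neq0 u) normrM normfV (gtr0_norm w_gt0).
by case: uv => ->; rewrite ?normrN ger0_norm.
Qed.

Lemma norm_4x_avg : `|4 * x - avg| = 4 * x * (x - 2) / (2 * x - 1).
Proof.
apply: norm_div; first by rewrite xE addrK !posE.
by right; rewrite /avg; field.
Qed.

Lemma norm_8x8_avg : `|8 * x - 8 - avg| = 4 * (x - 1) * (x - 2) / (2 * x - 1).
Proof.
apply: norm_div; last by left; rewrite /avg; field.
have -> : 4 * (x - 1) * (x - 2) = 4 * (y + 1) * y by rewrite xE; ring.
by rewrite !posE.
Qed.

Lemma norm_8x4_avg :
  `|8 * x - 4 - avg| = 4 * (x ^+ 2 - x + 1) / (2 * x - 1).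
Proof.
apply: norm_div; last by left; rewrite /avg; field.
have -> : x ^+ 2 - x + 1 = y ^+ 2 + 3 * y + 3 by rewrite xE; ring.
by rewrite !posE.
Qed.

Lemma norm_0_avg : `|0 - avg| = 12 * x * (x - 1) / (2 * x - 1).
Proof.
apply: norm_div; last by right; rewrite /avg; field.
have -> : x - 1 = y + 1 by rewrite xE; ring.
by rewrite !posE.
Qed.

(** Only [k = 0] and [k = 2] occur. The quadratic [x^2 - 5 x + 3] is negative at [x = 2] and [x = 4]
    and positive from [x = 6] on, which is why the signless energy has two cases. *)
Lemma norm_8x12_avg_le4 : (k.+2 <= 4)%N -> ~~ odd k ->
  `|8 * x - 12 - avg| = - (4 * (x ^+ 2 - 5 * x + 3)) / (2 * x - 1).
Proof.
move=> k_le2 k_even; apply: norm_div; last by right; rewrite /avg; field.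
have -> : - (4 * (x ^+ 2 - 5 * x + 3)) = 4 * (y * (2 - y) + 1 * (3 - y)).
  by rewrite xE; ring.
have := y_ge0; rewrite yE; case: (k) k_even k_le2 => [|[|[|//]]] // _ _ _.
  by rewrite mulr0n mul0r add0r mul1r subr0 !posE.
by rewrite subrr mulr0 add0r mul1r mulr_ge0 ?ler0n // subr_ge0 ler_nat.
Qed.

Lemma norm_8x12_avg_ge6 : (6 <= k.+2)%N ->
  `|8 * x - 12 - avg| = 4 * (x ^+ 2 - 5 * x + 3) / (2 * x - 1).
Proof.
move=> k_ge4; apply: norm_div; last by left; rewrite /avg; field.
(* The shift to [k - 4 = n - 6] makes all coefficients nonnegative. *)
have y4 : y = (k - 4)%:R + 4 by rewrite yE -natrD subnK.
have -> : x ^+ 2 - 5 * x + 3 = (k - 4)%:R ^+ 2 + 7 * (k - 4)%:R + 9.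
  by rewrite xE y4; ring.
by rewrite !posE.
Qed.

Let s2 : s ^+ 2 = 8 * y ^+ 2 + 16 * y + 9.
Proof. by rewrite sqrtCK xE; ring. Qed.

Let s_ge0 : 0 <= s.
Proof. by rewrite sqrtC_ge0 -[X in 0 <= X]sqrtCK -/s s2 !posE. Qed.

(** The midpoint [8 x - 6] exceeds [avg] by [v / (2 x - 1)], which is at most [2 s]. The two
    eigenvalues thus lie on either side of [avg], and their deviations add up to their
    difference. *)
Lemma norm_signless_pair :
  `|8 * x - 6 + 2 * s - avg| + `|8 * x - 6 - 2 * s - avg| = 4 * s.
Proof.
pose v := 4 * x ^+ 2 - 8 * x + 6.
have vE : v = 2 * (2 * y ^+ 2 + 4 * y + 3) by rewrite /v xE; ring.
have sw_ge0 : 0 <= s * (2 * x - 1) by rewrite mulr_ge0 // ltW.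
have v_ge0 : 0 <= v by rewrite vE !posE.
rewrite (@norm_div _ (v + 2 * s * (2 * x - 1))).
- rewrite (@norm_div _ (2 * s * (2 * x - 1) - v)); first by field.
  + rewrite vE -mulrA -mulrBr mulr_ge0 // subr_ge0.
    rewrite -(@ler_pXn2r _ 2) // ?nnegrE ?sw_ge0 ?posE //.
    rewrite exprMn s2 -subr_ge0 xE.
    set d := (X in 0 <= X).
    have -> : d = 28 * y ^+ 4 + 144 * y ^+ 3 + 272 * y ^+ 2 + 228 * y + 72.
      by rewrite /d; ring.
    by rewrite !posE.
  + by right; rewrite /avg /v; field.
- by rewrite -mulrA addr_ge0 // mulr_ge0.
- by left; rewrite /avg /v; field.
Qed.

(** Since [t >= x - 1], the first eigenvalue is nonnegative and the second nonpositive. *)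
Lemma norm_adj_pair :
  `|2 * (x - 1) + 2 * t| + `|2 * (x - 1) - 2 * t| = 4 * t.
Proof.
have x1E : x - 1 = y + 1 by rewrite xE; ring.
have t2 : t ^+ 2 = (y + 1) * (5 * y + 9) by rewrite sqrtCK xE; ring.
have t_ge0 : 0 <= t by rewrite sqrtC_ge0 -[X in 0 <= X]sqrtCK -/t t2 !posE.
have xt : y + 1 <= t.
  rewrite -(@ler_pXn2r _ 2) // ?nnegrE ?posE // t2 -subr_ge0.
  have -> : (y + 1) * (5 * y + 9) - (y + 1) ^+ 2 = 4 * ((y + 1) * (y + 2)).
    by ring.
  by rewrite !posE.
rewrite x1E ger0_norm ?posE // ler0_norm; first by ring.
by rewrite -mulrBr mulr_ge0_le0 // subr_le0.
Qed.

End Energies.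

(** * Spectra and energies of the non-commuting graph of V_8n *)

Lemma sum_tally_seq (V : nmodType) (T : eqType) (bs : seq (T * nat))
    (F : T -> V) :
  \sum_(z <- tally_seq bs) F z = \sum_(b <- bs) F b.1 *+ b.2.
Proof.
rewrite big_tally_seq; apply: eq_bigr => b _; exact: iter_addr_0.
Qed.

Theorem theorem5p13 (C : numClosedFieldType) (n : nat)
    (gT : finGroupType) (G : {group gT})
    (n_ge2 : (2 <= n)%N) (n_even : ~~ odd n) (G_V8n : is_V8n G n) :
  let x : C := n%:R in
  let s := sqrtC (8 * x ^+ 2 - 16 * x + 9) in
  let t := sqrtC ((x - 1) * (5 * x - 1)) in
  [/\ perm_eq (signless_spectrum C (nc_graph G))
        (tally_seq [:: (8 * x - 8, (3 * n)%N);
                       (4 * x, (4 * n - 5)%N);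
                       (8 * x - 12, (n - 1)%N);
                       (8 * x - 6 + 2 * s, 1%N);
                       (8 * x - 6 - 2 * s, 1%N)]),
      perm_eq (laplacian_spectrum C (nc_graph G))
        (tally_seq [:: (0, 1%N);
                       (4 * x, (4 * n - 5)%N);
                       (8 * x - 8, (3 * n)%N);
                       (8 * x - 4, n%N)]),
      perm_eq (adj_spectrum C (nc_graph G))
        (tally_seq [:: (0, (7 * n - 5)%N);
                       (- 4, (n - 1)%N);
                       (2 * (x - 1) + 2 * t, 1%N);
                       (2 * (x - 1) - 2 * t, 1%N)]),
      ((n <= 4)%N ->
         signless_energy C (nc_graph G) =
           (24 * x ^+ 3 - 64 * x ^+ 2 + 32 * x + 12) / (2 * x - 1) + 4 * s)
      /\ ((6 <= n)%N ->
         signless_energy C (nc_graph G) =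
           (32 * x ^+ 3 - 112 * x ^+ 2 + 96 * x - 12) / (2 * x - 1) + 4 * s)
    & laplacian_energy C (nc_graph G) =
        8 * x * (4 * x ^+ 2 - 10 * x + 7) / (2 * x - 1)
      /\ energy C (nc_graph G) = 4 * (x - 1) + 4 * t].
Proof.
move=> x s t.
have [A [sAG abA nabG [oG oA oZ]]] := V8n_structure n_ge2 n_even G_V8n.
have n_gt0 : (0 < n)%N by apply: leq_trans n_ge2.
have iA : #|G : A|%g = 2%N.
  by rewrite -divgS // oG oA -[8%N]/(2 * 4)%N -mulnA mulnK // muln_gt0.
(* The centre has index [2n] in [G] and [n] in [A], which leaves [n] small parts. *)
have oB : #|nc_small_parts G A| = (n - 1).+1.
  rewrite card_nc_small_parts //.
  rewrite -!divgS ?center_sub ?(center_sub_index2 sAG abA iA) //.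
  by rewrite oG oA oZ; lia.
have sE X : #|[set u : nc_graph G | nc_part A u == X]| =
    (if X == A then (4 * n - 5).+1 else
     if X \in nc_small_parts G A then 3.+1 else 0)%N.
  by rewrite (card_nc_part sAG abA iA nabG) oA oZ; case: ifP => // _; lia.
have adjE := nc_adj_part sAG abA iA.
have AB := nc_big_part sAG abA iA nabG.
have [k nE] : exists k, n = k.+2 by exists (n - 2)%N; lia.
pose y : C := k%:R.
have xE : x = y + 2 by rewrite /x nE -addn2 natrD.
have n1E : (n - 1)%:R = x - 1 by rewrite natrB.
have n5E : (4 * n - 5)%:R = 4 * x - 5 by rewrite natrB ?natrM //; lia.
have m1E : (4 * n - 5).+1%:R = 4 * x - 4 by rewrite -natr1 n5E; ring.
have r1E : (n - 1).+1%:R = x by rewrite -natr1 n1E subrK.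
have w_neq0 : 2 * x - 1 != 0.
  have -> : 2 * x - 1 = (2 * k + 3)%:R by rewrite xE natrD natrM; ring.
  by rewrite pnatr_eq0 addn_eq0 andbF.
have avgE : avg_degree C (nc_graph G) = 12 * x * (x - 1) / (2 * x - 1).
  rewrite /avg_degree (card_edges adjE AB oB sE) (card_vertices AB oB sE).
  rewrite !(natrD, natrM) m1E r1E n1E.
  have -> : 4 * x - 4 + x * 4 = 4 * (2 * x - 1) by ring.
  by field; rewrite w_neq0.
have degE (v : nc_graph G) :
    (degree v)%:R = (if nc_part A v == A then 4 * x else 8 * x - 8).
  rewrite (degreeE adjE AB oB sE); case: ifP => _.
    by rewrite natrM r1E mulrC.
  by rewrite natrD natrM m1E n1E; ring.
have s2 : s ^+ 2 = 8 * x ^+ 2 - 16 * x + 9 by rewrite sqrtCK.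
have t2 : t ^+ 2 = (x - 1) * (5 * x - 1) by rewrite sqrtCK.
have Q_spec : perm_eq (signless_spectrum C (nc_graph G))
    (tally_seq [:: (8 * x - 8, (3 * n)%N); (4 * x, (4 * n - 5)%N);
                   (8 * x - 12, (n - 1)%N); (8 * x - 6 + 2 * s, 1%N);
                   (8 * x - 6 - 2 * s, 1%N)]).
  (* Here [a = X - 4] and [b = X - (8 x - 12)]; the quadratic factor is
     [(X - (8 x - 6))^2 - 4 s^2]. *)
  apply: (eigenvalues_parts adjE AB oB sE (c := 1)) => [i j|X].
    by rewrite !mxE degE mul1r.
  rewrite /= !big_cons big_nil /= natrM m1E r1E !expr1 mulr1 subn1 prednK //.
  have -> : (X - (8 * x - 6 + 2 * s)) * (X - (8 * x - 6 - 2 * s)) =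
    (X - (8 * x - 6)) ^+ 2 - 4 * s ^+ 2 by ring.
  have -> : X - (8 * x - 8) + 1 * 4 = X - (8 * x - 12) by ring.
  by rewrite s2; ring.
have L_spec : perm_eq (laplacian_spectrum C (nc_graph G))
    (tally_seq [:: (0, 1%N); (4 * x, (4 * n - 5)%N); (8 * x - 8, (3 * n)%N);
                   (8 * x - 4, n%N)]).
  (* Here [a] and [b] both equal [X - (8 x - 4)] and the quadratic factor is [X a], so [8 x - 4] has
     multiplicity [(n - 1) + 1]. *)
  apply: (eigenvalues_parts adjE AB oB sE (c := -1)) => [i j|X].
    by rewrite !mxE degE mulN1r.
  rewrite /= !big_cons big_nil /= natrM m1E r1E !expr1 mulr1 subn1 prednK //.
  have -> : X - (8 * x - 8) + -1 * 4 = X - (8 * x - 4) by ring.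
  have -> : (X - (8 * x - 4)) ^+ n = (X - (8 * x - 4)) * (X - (8 * x - 4)) ^+ n.-1.
    by rewrite -exprS prednK.
  by ring.
have A_spec : perm_eq (adj_spectrum C (nc_graph G))
    (tally_seq [:: (0, (7 * n - 5)%N); (- 4, (n - 1)%N);
                   (2 * (x - 1) + 2 * t, 1%N); (2 * (x - 1) - 2 * t, 1%N)]).
  (* The eigenvalue 0 arises [4n - 5] times from the big part and [3n] times from the small ones. *)
  apply: (eigenvalues_parts adjE AB oB sE (c := 1) (d0 := 0) (d1 := 0)).
    by move=> i j; rewrite !mxE if_same mul0rn add0r mul1r.
  move=> X; rewrite /= !big_cons big_nil /= natrM m1E r1E !expr1 mulr1 subn1 prednK //.
  have -> : (X - (2 * (x - 1) + 2 * t)) * (X - (2 * (x - 1) - 2 * t)) =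
    (X - 2 * (x - 1)) ^+ 2 - 4 * t ^+ 2 by ring.
  have -> : (7 * n - 5 = 4 * n - 5 + 3 * n)%N by lia.
  have -> : X - 0 + 1 * 4 = X - - 4 by ring.
  by rewrite exprD t2; ring.
split=> //.
- rewrite /signless_energy (perm_big _ Q_spec) sum_tally_seq !big_cons big_nil /=.
  rewrite avgE !mulr1n addr0.
  rewrite (norm_8x8_avg (erefl y) xE) (norm_4x_avg (erefl y) xE).
  rewrite (norm_signless_pair (erefl y) xE) -[_ *+ (3 * n)]mulr_natr.
  rewrite -[_ *+ (4 * n - 5)]mulr_natr -[_ *+ (n - 1)]mulr_natr natrM n5E n1E -/x -/s.
  split=> n_bd.
    rewrite (norm_8x12_avg_le4 (erefl y) xE) -?nE //; first by field.
    by move: n_even; rewrite nE /= negbK.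
  by rewrite (norm_8x12_avg_ge6 (erefl y) xE) -?nE //; field.
split.
- rewrite /laplacian_energy (perm_big _ L_spec) sum_tally_seq !big_cons big_nil /=.
  rewrite avgE !mulr1n addr0 (norm_0_avg (erefl y) xE) (norm_4x_avg (erefl y) xE).
  rewrite (norm_8x8_avg (erefl y) xE) (norm_8x4_avg (erefl y) xE).
  rewrite -[_ *+ (3 * n)]mulr_natr -[_ *+ (4 * n - 5)]mulr_natr.
  by rewrite -[_ / _ *+ n]mulr_natr natrM n5E -/x; field.
- rewrite /energy (perm_big _ A_spec) sum_tally_seq !big_cons big_nil /=.
  rewrite !mulr1n addr0 (norm_adj_pair (erefl y) xE) normr0 mul0rn add0r.
  by rewrite normrN normr_nat -[_ *+ (n - 1)]mulr_natr n1E -/t.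
Qed.
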